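(* There is a function $G(d)>0$ such that the following holds. Let $C\subset\mathbb{R}^d$ be a convex body and $\mu$ a non-$C$-degenerate measure on $\mathbb{R}^d$ with $\mu(C)>0$ and $\mu(\mathbb{R}^d)>\mu(C)$. Then $\delta_H(\mu,C)\ge G(d)$.
   Context: A convex body is a convex compact set with nonempty interior; a homothet of $C$ is $\lambda C+x$ with $\lambda>0$, $x\in\mathbb{R}^d$. Measures are Borel measures on $\mathbb{R}^d$ finite on compact sets; $\mu$ is non-$C$-degenerate if it vanishes on the boundary of every homothet of $C$. Let $B^d$ be the open unit Euclidean ball centered at the origin. For a family $\mathcal{A}$ of sets of finite measure and a set $D$ of finite positive measure, $d_{\mathrm{out}}(\mu,\mathcal{A}|D)=\frac{1}{\mu(D)}\sum_{A\in\mathcal{A},A\cap D\neq\emptyset}\mu(A)$, and $d_{\mathrm{upp}}(\mu,\mathcal{A})=\limsup_{r\to\infty}d_{\mathrm{out}}(\mu,\mathcal{A}|rB^d)$. The homothety packing density with respect to $\mu$ is $\delta_H(\mu,C)=\sup\{d_{\mathrm{upp}}(\mu,\mathcal{P})\}$, where the supremum is over all packings $\mathcal{P}$ (families of sets with pairwise disjoint interiors) of homothets of $C$ each of $\mu$-measure exactly $\mu(C)$. *)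

(* Defs.v *)
From HB Require Import structures.
From mathcomp Require Import all_boot all_order all_algebra.
From mathcomp Require Import all_classical all_reals all_analysis.
Set Implicit Arguments. Unset Strict Implicit. Unset Printing Implicit Defensive.
Import Order.TTheory GRing.Theory Num.Theory.
Import numFieldNormedType.Exports.
Local Open Scope classical_set_scope.
Local Open Scope ring_scope.

Section Defs.
Variables (R : realType) (d : nat).
Notation V := 'rV[R]_d.

(* Euclidean norm on R^d (the built-in norm on 'rV is the max norm;
   both induce the same topology). *)
Definition enorm (x : V) : R := Num.sqrt (\sum_(i < d) (x ord0 i) ^+ 2).

Definition eball (r : R) : set V := [set x | enorm x < r].

Definition borel_set (A : set V) : Prop := <<s open >> A.

(* Borel measure on R^d, finite on compact sets.  Only its values on Borel
   sets are meaningful. *)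
Definition is_borel_measure (mu : set V -> \bar R) : Prop :=
  [/\ mu set0 = 0%E,
      (forall A, borel_set A -> (0 <= mu A)%E),
      (forall F : nat -> set V, (forall n, borel_set (F n)) ->
          trivIset setT F ->
          (fun n => \sum_(k < n) mu (F k))%E @ \oo --> mu (\bigcup_k F k)) &
      (forall K, compact K -> (mu K < +oo)%E)].

Definition convex_set (C : set V) : Prop :=
  forall x y (t : R), C x -> C y -> 0 <= t <= 1 -> C (t *: x + (1 - t) *: y).

Definition convex_body (C : set V) : Prop :=
  [/\ convex_set C, compact C & interior C !=set0].

Definition homothet (C : set V) (lambda : R) (x : V) : set V :=
  [set lambda *: c + x | c in C].

Definition is_homothet_of (C H : set V) : Prop :=
  exists lambda x, 0 < lambda /\ H = homothet C lambda x.

Definition boundary (A : set V) : set V := closure A `\` interior A.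

Definition non_degenerate (mu : set V -> \bar R) (C : set V) : Prop :=
  forall lambda x, 0 < lambda -> mu (boundary (homothet C lambda x)) = 0%E.

Definition d_out (mu : set V -> \bar R) (A : set (set V)) (D : set V) : \bar R :=
  ((\esum_(X in [set X | A X /\ X `&` D !=set0]) mu X)
     * ((fine (mu D))^-1)%:E)%E.

Definition d_upp (mu : set V -> \bar R) (A : set (set V)) : \bar R :=
  ereal_inf [set ereal_sup [set d_out mu A (eball r) | r in [set r | r0 <= r]]
            | r0 in [set: R]].

Definition packing (P : set (set V)) : Prop :=
  forall X Y, P X -> P Y -> X <> Y -> interior X `&` interior Y = set0.

Definition hom_packing (mu : set V -> \bar R) (C : set V) (P : set (set V)) : Prop :=
  packing P /\ (forall X, P X -> is_homothet_of C X /\ mu X = mu C).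

Definition delta_H (mu : set V -> \bar R) (C : set V) : \bar R :=
  ereal_sup [set d_upp mu P | P in hom_packing mu C].

End Defs.

(* Main.v *)
Require Import Defs.
From HB Require Import structures.
From mathcomp Require Import all_boot all_order all_algebra.
From mathcomp Require Import all_classical all_reals all_analysis.
From mathcomp Require Import perm ring lra.
Import Order.TTheory GRing.Theory Num.Theory.
Import numFieldNormedType.Exports.
Local Open Scope classical_set_scope.
Local Open Scope ring_scope.

(** Around every point there is a homothet of measure exactly mu(C): by
    non-degeneracy the measure of x + l (C - c) varies continuously with l. As
    all these homothets have the same measure, a greedy choice replaces the
    Besicovitch covering theorem: repeatedly pick the homothet of almost
    smallest size and discard the centers whose homothets meet it. The discarded
    centers near the chosen one are covered by boundedly many homothets since
    their sizes are bounded below, and the far ones by one homothet for each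
    narrow cone, the one with almost farthest center. So n chosen homothets
    cover the ball up to a constant factor in measure. The constants depend only
    on the dimension once C is put in position with an inscribed simplex of
    almost maximal volume. If mu is infinite, the packing is extended
    infinitely often: the homothets with far center that meet a fixed ball are
    again covered by boundedly many of them, so that avoiding the
    homothets chosen before costs a bounded amount of measure only. *)

Set Implicit Arguments.
Unset Strict Implicit.
Unset Printing Implicit Defensive.

(** * Near-maximizers, the max norm of matrices, and grid cells of a cube *)

Section Preliminaries.
Variable R : realType.

(** Suprema need not be attained, so a loss of a factor q replaces an extremal choice. This serves
    for the simplex of large volume, for the smallest homothet and for the farthest center in a
    cone. *)
Lemma near_argmax (T : Type) (A : set T) (f : T -> R) (q : R) :
  1 < q -> A !=set0 -> (forall x, A x -> 0 < f x) ->
  (exists M, forall x, A x -> f x <= M) ->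
  exists2 x, A x & forall y, A y -> f y <= q * f x.
Proof.
move=> q1 [x0 Ax0] fpos [M fM].
have q0 : 0 < q by lra.
have hs : has_sup (f @` A).
  by split; [exists (f x0), x0|exists M => _ [y Ay <-]; exact: fM].
have le_s y : A y -> f y <= sup (f @` A).
  by move=> Ay; apply: (ub_le_sup hs.2); exists y.
have s0 : 0 < sup (f @` A) by apply: lt_le_trans (le_s _ Ax0); exact: fpos.
(* With this slack, the supremum minus the slack is the supremum divided by q. *)
have e0 : 0 < sup (f @` A) * (1 - q^-1).
  by rewrite mulr_gt0// subr_gt0 invf_lt1.
have [_ [x Ax <-] hx] := sup_adherent e0 hs.
exists x => // y Ay; apply: (le_trans (le_s _ Ay)).
have : sup (f @` A) / q < f x.
  by apply: le_lt_trans hx; rewrite mulrBr mulr1 opprB addrC subrK.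
by rewrite ltr_pdivrMr// mulrC => /ltW.
Qed.

Lemma normmx_leP m n (x : 'M[R]_(m, n)) (e : R) :
  0 <= e -> reflect (forall i j, `|x i j| <= e) (`|x| <= e).
Proof.
move=> e0; rewrite /Num.norm/= mx_normrE; apply: (iffP idP).
  move=> /bigmax_leP [_ h] i j; exact: (h (i, j)).
by move=> h; apply/bigmax_leP; split => // -[i j] _; exact: h.
Qed.

Lemma normmx_ge m n (x : 'M[R]_(m, n)) i j : `|x i j| <= `|x|.
Proof. by move: i j; apply/normmx_leP. Qed.

Lemma normmxM m n p (x : 'M[R]_(m, n)) (y : 'M[R]_(n, p)) :
  `|x *m y| <= n%:R * (`|x| * `|y|).
Proof.
apply/normmx_leP; first by rewrite !mulr_ge0.
move=> i j; rewrite mxE; apply: (le_trans (ler_norm_sum _ _ _)).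
rewrite mulr_natl; set c := `|x| * `|y|.
have -> : c *+ n = \sum_(k < n) c by rewrite sumr_const card_ord.
apply: ler_sum => k _.
by rewrite normrM ler_pM// normmx_ge.
Qed.

(** Cells of side 1/k in the cube [-1, 1]^d. A coordinate equal to 1 gets the index 2k, hence 2k + 1
    indices. Outside the cube [inord] may return its default value, so the class is informative only
    for [|x| <= 1]. *)
Definition grid_class (d k : nat) (x : 'rV[R]_d) : {ffun 'I_d -> 'I_(k.*2).+1} :=
  [ffun i => inord (Num.trunc (k%:R * (x ord0 i + 1)))].

Lemma grid_class_close d k (x y : 'rV[R]_d) : `|x| <= 1 -> `|y| <= 1 ->
  grid_class k x = grid_class k y -> k%:R * `|x - y| <= 1.
Proof.
have bd (z : 'rV[R]_d) i : `|z| <= 1 ->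
    0 <= k%:R * (z ord0 i + 1) <= k.*2%:R.
  move=> z1; have := le_trans (normmx_ge z ord0 i) z1.
  rewrite ler_norml => /andP[h1 h2]; rewrite mulr_ge0//=; last lra.
  by rewrite -muln2 natrM ler_wpM2l//; lra.
have [->|k0] := posnP k; first by rewrite mul0r.
move=> x1 y1 xy; rewrite mulrC -ler_pdivlMr ?ltr0n// mul1r.
apply/normmx_leP => [|i j]; first by rewrite invr_ge0.
rewrite ord1 -[leRHS]mul1r ler_pdivlMr ?ltr0n// mulrC !mxE.
move/ffunP: xy => /(_ j); rewrite !ffunE => /(congr1 val) /=.
have [hx0 hx] := andP (bd x j x1); have [hy0 hy] := andP (bd y j y1).
have [tx1 tx2] := andP (truncn_itv hx0).
have [ty1 ty2] := andP (truncn_itv hy0).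
(* The integer parts are at most 2k, so [inord] keeps them; equal integer parts then force a
   difference of at most 1. *)
rewrite !inordK ?ltnS -?(ler_nat R); [|exact: le_trans hy|exact: le_trans hx].
move=> e; rewrite e in tx1 tx2.
rewrite -{1}[k%:R]normr_nat -normrM ler_norml.
rewrite -natr1 in tx2 ty2.
by rewrite mulrBr; apply/andP; split; lra.
Qed.

End Preliminaries.

(** The 3 is the bound 2 on coordinates in the inscribed simplex plus 1 for the shift to its
    centroid; the square comes from rescaling the inner cube to half side 1. *)
Definition kap (R : realType) (d : nat) : R := 3 * d.+1%:R ^+ 2.

(** * Affine position of a convex body between two cubes of bounded ratio *)

Section JohnPosition.
Variables (R : realType) (d : nat).
Notation V := 'rV[R]_d.
Implicit Types (C : set V).

(** The missing weight goes to the point 0. The induction shows that the sum is its total weight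
    times a point of C, which makes sense for total weight 0 too. *)
Lemma convex_comb n C (a : 'I_n -> R) (q : 'I_n -> V) :
  Defs.convex_set C -> C 0 -> (forall i, 0 <= a i) -> (forall i, C (q i)) ->
  \sum_i a i <= 1 -> C (\sum_i a i *: q i).
Proof.
move=> Cc C0 a0 Cq a1.
suff [p Cp ->] : exists2 p, C p & \sum_i a i *: q i = (\sum_i a i) *: p.
  have := Cc p 0 (\sum_i a i) Cp C0; rewrite scaler0 addr0; apply.
  by rewrite a1 andbT sumr_ge0.
elim: n a q a0 Cq {a1} => [|n IH] a q a0 Cq.
  by exists 0; rewrite // !big_ord0 scaler0.
rewrite !big_ord_recl; set a' := fun i => a (lift ord0 i).
set q' := fun i => q (lift ord0 i).
have [p Cp e] := IH a' q' (fun i => a0 _) (fun i => Cq _).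
rewrite -/(a' _) [X in _ + X]e; set s := \sum_i a' i.
have s0 : 0 <= s by apply: sumr_ge0 => i _; exact: a0.
have [z|nz] := eqVneq (a ord0 + s) 0.
  exists 0 => //; rewrite z scale0r.
  have ha : a ord0 = 0 by have := a0 ord0; lra.
  have hs : s = 0 by lra.
  by rewrite ha hs !scale0r addr0.
have t0 : 0 < a ord0 + s by rewrite lt_def nz addr_ge0 ?a0.
exists ((a ord0 / (a ord0 + s)) *: q ord0 + (1 - a ord0 / (a ord0 + s)) *: p).
  apply: Cc => //; apply/andP; split; first by rewrite divr_ge0 ?a0// ltW.
  by rewrite ler_pdivrMr// mul1r lerDl.
rewrite scalerDr !scalerA mulrBr mulr1 mulrCA divff// mulr1.
by congr (_ + _ *: _); rewrite addrC addKr.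
Qed.

Definition simplex_mx (p : V * ('I_d -> V)) : 'M[R]_d :=
  \matrix_i (p.2 i - p.1).

Lemma det_bounded (B : R) : 0 <= B ->
  exists M : R, forall W : 'M[R]_d, `|W| <= B -> `|\det W| <= M.
Proof.
move=> B0; exists (\sum_(s : 'S_d) \prod_(i < d) B) => W WB.
rewrite /determinant; apply: (le_trans (ler_norm_sum _ _ _)).
apply: ler_sum => s _; rewrite normrM normrX normrN normr1 expr1n mul1r.
rewrite normr_prod; apply: ler_prod => i _; rewrite normr_ge0/=.
exact: le_trans (normmx_ge _ _ _) WB.
Qed.

(* Cramer's rule *)
Lemma simplex_coord (p : V * ('I_d -> V)) (z : V) (i : 'I_d) :
  simplex_mx p \in unitmx ->
  \det (simplex_mx (p.1, fun j => if j == i then z else p.2 j)) =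
  ((z - p.1) *m invmx (simplex_mx p)) ord0 i * \det (simplex_mx p).
Proof.
move=> U; set W' := simplex_mx (_, _); set W := simplex_mx p.
have D0 : \det W != 0 by rewrite -unitfE -unitmxE.
rewrite (expand_det_row W' i) /invmx U -scalemxAr mxE mulrAC mulVf// mul1r.
rewrite mxE; apply: eq_bigr => j _.
have -> : W' i j = (z - p.1) ord0 j by rewrite !mxE /= eqxx.
rewrite [(\adj W) j i]mxE; congr (_ * _).
(* The two matrices differ in row i only, and the cofactors along row i do not involve that row. *)
rewrite /cofactor; congr (_ * \det _); apply/matrixP => k l.
by rewrite !mxE/= eq_sym (negbTE (neq_lift _ _)).
Qed.

(** A corner simplex with edges e/2 along the axes fits in a ball inside C, and its edge matrix is
    scalar. *)
Lemma simplex_nondegenerate C : interior C !=set0 -> exists p : V * ('I_d -> V),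
  [/\ C p.1, (forall i, C (p.2 i)) & \det (simplex_mx p) != 0].
Proof.
move=> [x0 /nbhs_ballP [e /= e0 eC]].
exists (x0, fun i => x0 + (e / 2) *: delta_mx ord0 i); split => /=.
- by apply: eC; exact: ballxx.
- move=> i; apply: eC; rewrite -ball_normE /ball_ /= opprD addNKr normrN.
  rewrite normrZ gtr0_norm ?divr_gt0//; apply: (@le_lt_trans _ _ (e / 2 * 1)).
    rewrite ler_pM2l ?divr_gt0//; apply/normmx_leP => // k j; rewrite mxE.
    by rewrite normr_nat lern1 leq_b1.
  by rewrite mulr1; lra.
- have -> : simplex_mx (x0, fun i => x0 + (e / 2) *: delta_mx ord0 i)
      = (e / 2)%:M.
    apply/matrixP => i j; rewrite !mxE /= addrC addKr.
    by rewrite mulr_natr eq_sym.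
  by rewrite det_scalar expf_neq0// gt_eqF// divr_gt0.
Qed.

(* With respect to an inscribed simplex whose volume is at least half of the
   supremum, points of C have coordinates in [-2, 2]. The point c is the centroid
   of this simplex, around which it contains a cube of half side (d + 1)^-2. *)
Lemma john_position C : convex_body C -> exists (c : V) (L : 'M[R]_d),
  [/\ L \in unitmx, (forall x, `|x *m L| <= 1 -> C (c + x)) &
     (forall x, C (c + x) -> `|x *m L| <= kap R d)].
Proof.
move=> [Cc Ck Ci].
have [p [Cp1 Cp2 detp] pmax] : exists2 p : V * ('I_d -> V),
    [/\ C p.1, (forall i, C (p.2 i)) & \det (simplex_mx p) != 0]
  & forall p' : V * ('I_d -> V),
    [/\ C p'.1, (forall i, C (p'.2 i)) & \det (simplex_mx p') != 0] ->
    `|\det (simplex_mx p')| <= 2 * `|\det (simplex_mx p)|.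
  apply: (@near_argmax _ _
    [set p : V * ('I_d -> V) | [/\ C p.1, (forall i, C (p.2 i)) & _]]).
  - by rewrite ltr1n.
  - exact: simplex_nondegenerate.
  - by move=> p [_ _]; rewrite normr_gt0.
  - have [B [_ hB]] := compact_bounded Ck.
    have CB x : C x -> `|x| <= `|B| + 1.
      by apply: hB; rewrite (le_lt_trans (ler_norm B))// ltrDl.
    have [M hM] := @det_bounded (`|B| + 1 + (`|B| + 1)) ltac:(by rewrite !addr_ge0).
    exists M => p [h1 h2 _]; apply: hM; apply/normmx_leP.
      by rewrite !addr_ge0.
    move=> i j; rewrite mxE; apply: (le_trans (normmx_ge _ _ _)).
    apply: (le_trans (ler_normB _ _)); apply: lerD; exact: CB.
set W := simplex_mx p.
have WU : W \in unitmx by rewrite unitmxE unitfE.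
(* Up to sign, coordinate i is the volume with vertex i replaced by z over the original volume: at
   most 2 by the choice of p, and 0 if the new simplex is degenerate. *)
have coord z : C z -> `|(z - p.1) *m invmx W| <= 2.
  move=> Cz; apply/normmx_leP => // k i; rewrite ord1.
  have D := simplex_coord z i WU.
  have W0 : 0 < `|\det W| by rewrite normr_gt0.
  rewrite -(ler_pM2r W0) -normrM -D.
  have [->|nz] := eqVneq (\det (simplex_mx
    (p.1, fun j => if j == i then z else p.2 j))) 0.
    by rewrite normr0 mulr_ge0.
  by apply: pmax; split => //= j; case: ifP.
set D := d.+1%:R : R.
have D0 : 0 < D by rewrite ltr0n.
have D1 : 1 <= D by rewrite ler1n.
(* All barycentric coordinates of the centroid equal 1/(d + 1). *)
pose u : V := const_mx D^-1.
have k0 : 0 < D ^+ 2 by rewrite exprn_gt0.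
exists (p.1 + u *m W), (D ^+ 2 *: invmx W); split.
- by rewrite unitmxZ ?unitmx_inv// unitfE gt_eqF.
- move=> x; rewrite -scalemxAr; set b := x *m invmx W => hb.
  have {}hb i : `|b ord0 i| <= (D ^+ 2)^-1.
    rewrite -[leRHS]mul1r ler_pdivlMr// mulrC.
    rewrite -[X in X * _](gtr0_norm k0) -normrM.
    by apply: le_trans hb; apply: le_trans (normmx_ge _ ord0 i); rewrite !mxE.
  have -> : p.1 + u *m W + x = p.1 + (u + b) *m W.
    by rewrite mulmxDl mulmxKV// addrA.
  have Dsq : (D ^+ 2)^-1 <= D^-1.
    by rewrite lef_pV2 ?posrE// expr2 ler_peMr// ltW.
  pose C0 : set V := [set v | C (p.1 + v)].
  rewrite mulmx_sum_row; apply: (@convex_comb _ C0).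
  + move=> y z t Cy Cz t01; rewrite /C0/=.
    have -> : p.1 + (t *: y + (1 - t) *: z) =
        t *: (p.1 + y) + (1 - t) *: (p.1 + z).
      by rewrite !scalerDr addrACA -scalerDl [t + _]addrC subrK scale1r.
    exact: Cc.
  + by rewrite /C0/= addr0.
  + move=> i; have := hb i; rewrite ler_norml => /andP[h _].
    rewrite mxE [u _ _]mxE -lerBlDl sub0r; apply: le_trans h.
    by rewrite lerN2.
  + by move=> i; rewrite /C0/= rowK addrC subrK.
  (* With D = d + 1, the weights sum to at most d (1/D + 1/D^2) = 1 - 1/D^2. *)
  + apply: (@le_trans _ _ (\sum_(i < d) (D^-1 + (D ^+ 2)^-1))).
      apply: ler_sum => i _; rewrite mxE [u _ _]mxE lerD2l.
      exact: le_trans (ler_norm _) (hb i).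
    rewrite sumr_const card_ord -mulr_natr.
    have -> : d%:R = D - 1 by rewrite /D -natr1 addrK.
    have -> : (D^-1 + (D ^+ 2)^-1) * (D - 1) = 1 - (D ^+ 2)^-1.
      by field; rewrite gt_eqF.
    by rewrite lerBlDr lerDl invr_ge0 ltW.
- move=> x Cx; have := coord _ Cx.
  rewrite addrAC [p.1 + _]addrC addrK mulmxDl mulmxK// => h.
  rewrite -scalemxAr normrZ gtr0_norm// /kap mulrC -/D ler_pM2r//.
  have -> : x *m invmx W = (u + x *m invmx W) - u by rewrite addrAC subrr add0r.
  apply: (le_trans (ler_normB _ _)).
  have -> : 3 = 2 + 1 :> R by lra.
  apply: lerD => //; apply/normmx_leP => // i j; rewrite mxE.
  by rewrite ger0_norm ?invr_ge0 ?(ltW D0)// invf_le1.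
Qed.

End JohnPosition.

(** * Coverings by boundedly many homothets and the greedy selection *)

Section Selection.
Variables (R : realType) (d : nat).
Notation V := 'rV[R]_d.
Variables (C : set V) (L : 'M[R]_d) (kp : R) (k : nat) (lam : V -> R).
Hypothesis C_convex : Defs.convex_set C.
Hypothesis C_inner : forall x, `|x *m L| <= 1 -> C x.
Hypothesis C_outer : forall x, C x -> `|x *m L| <= kp.
Hypothesis kp_ge1 : 1 <= kp.
Hypothesis k_large : 16 * kp ^+ 2 <= k%:R.
Hypothesis lam_gt0 : forall x, 0 < lam x.

Let N (x : V) : R := `|x *m L|.
Let Y (x : V) : set V := homothet C (lam x) x.

Let kp0 : 0 < kp. Proof. by rewrite (lt_le_trans ltr01). Qed.

Let k0 : 0 < k%:R :> R.
Proof. by apply: lt_le_trans k_large; rewrite mulr_gt0// exprn_gt0. Qed.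

Let ND x y : N (x + y) <= N x + N y.
Proof. by rewrite /N mulmxDl ler_normD. Qed.

Let NZ a x : N (a *: x) = `|a| * N x.
Proof. by rewrite /N -scalemxAl normrZ. Qed.

Let NC x y : N (x - y) = N (y - x).
Proof. by rewrite -opprB -scaleN1r NZ normrN1 mul1r. Qed.

Lemma homothetP l x y : 0 < l -> homothet C l x y <-> C (l^-1 *: (y - x)).
Proof.
move=> l0; have l1 : l != 0 by rewrite gt_eqF.
split => [[c Cc <-]|h]; first by rewrite addrK scalerA mulVf// scale1r.
by exists (l^-1 *: (y - x)) => //; rewrite scalerA divff// scale1r subrK.
Qed.

Lemma homothet_inner l x y : 0 < l -> N (y - x) <= l -> homothet C l x y.
Proof.
move=> l0 h; apply/homothetP => //; apply: C_inner.
rewrite -/(N _) NZ gtr0_norm ?invr_gt0// mulrC.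
by rewrite ler_pdivrMr// mul1r.
Qed.

Lemma homothet_outer l x y : 0 < l -> homothet C l x y -> N (y - x) <= kp * l.
Proof.
move=> l0 [c /C_outer h <-]; rewrite addrK NZ gtr0_norm// mulrC.
by rewrite ler_pM2r.
Qed.

Lemma homothet_convex l x : 0 < l -> Defs.convex_set (homothet C l x).
Proof.
move=> l0 y z t /homothetP hy /homothetP hz t01; apply/homothetP => //.
have := C_convex (hy l0) (hz l0) t01; congr C.
rewrite !scalerA ![_ * l^-1]mulrC -!scalerA -scalerDr; congr (_ *: _).
rewrite !scalerBr addrACA -opprD -scalerDl.
by rewrite [t + _]addrC subrK scale1r.
Qed.

Let K := #|{: {ffun 'I_d -> 'I_(k.*2).+1}}|.

(** One representative per class suffices. The choice is option-valued because a class may be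
    empty. *)
Lemma class_cover (T : finType) (cl : V -> T) (F : set V) :
  (forall t, (exists2 y, F y & cl y = t) ->
     exists2 x, F x & forall y, F y -> cl y = t -> Y x y) ->
  exists ys : seq V, [/\ (size ys <= #|T|)%N, (forall x, x \in ys -> F x) &
    forall y, F y -> exists2 x, x \in ys & Y x y].
Proof.
move=> h.
have /choice [rep hrep] : forall t, exists o : option V,
    (forall x, o = Some x -> F x) /\
    (forall y, F y -> cl y = t -> exists2 x, o = Some x & Y x y).
  move=> t; have [/h [x Fx hx]|nex] := pselect (exists2 y, F y & cl y = t).
    by exists (Some x); split => [_ [<-]//|y Fy ct]; exists x => //; exact: hx.
  by exists None; split => // y Fy ct; case: nex; exists y.
exists (pmap rep (enum T)); split.
- by rewrite size_pmap (leq_trans (count_size _ _))// cardE.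
- by move=> x; rewrite mem_pmap => /mapP [t _ /esym]; exact: (hrep t).1.
- move=> y Fy; have [x e Yx] := (hrep (cl y)).2 y Fy erefl.
  by exists x => //; rewrite mem_pmap; apply/mapP; exists (cl y); rewrite ?mem_enum.
Qed.

(** Measured after applying L, directions have max norm 1, so the grid of the cube sorts them into
    boundedly many narrow cones. *)
Definition direction (x1 y : V) : V := (N (y - x1))^-1 *: ((y - x1) *m L).

Let norm_direction x1 y : 0 < N (y - x1) -> `|direction x1 y| = 1.
Proof.
move=> n0; rewrite /direction normrZ gtr0_norm ?invr_gt0//.
by rewrite -/(N _) mulVf// gt_eqF.
Qed.

(* The homothet at x contains its touching point z near x1 and a ball around x
   of radius proportional to N (x - x1), hence the convex hull of both; this
   hull contains every y in a thin cone around x whose distance from x1 is at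
   most slightly larger than that of x. *)
Lemma cone_cover (x1 x y z : V) (s eps : R) :
  eps = (16 * kp)^-1 -> 0 < s ->
  8 * kp * s <= N (x - x1) -> 8 * kp * s <= N (y - x1) ->
  N (y - x1) <= (1 + eps) * N (x - x1) ->
  `|direction x1 y - direction x1 x| <= eps ->
  Y x z -> N (z - x1) <= s -> Y x y.
Proof.
move=> epsE s0 hx hy hyx hdir Yz hz.
have eps0 : 0 < eps by rewrite epsE invr_gt0 mulr_gt0.
have kpe : kp * eps = 16^-1 by rewrite epsE; field; rewrite gt_eqF.
have eps1 : eps <= 1.
  have : eps <= kp * eps by rewrite ler_peMl// ltW.
  by rewrite kpe; lra.
have ks0 : 0 < 8 * kp * s by rewrite !mulr_gt0.
set n := N (x - x1) in hx hyx *; set m := N (y - x1) in hy hyx *.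
have n0 : 0 < n by exact: lt_le_trans hx.
have m0 : 0 < m by exact: lt_le_trans hy.
set q := 1 + eps in hyx *.
have q0 : 0 < q by rewrite /q; lra.
set l := lam x; have l0 : 0 < l by exact: lam_gt0.
(* z lies in the homothet at x and within n / 8 of x1, so this homothet has size at least comparable
   to n. *)
have hl : n <= 2 * kp * l.
  have h1 : N (x - z) <= kp * l by rewrite NC; exact: homothet_outer.
  have h2 : n <= N (x - z) + N (z - x1).
    by rewrite /n -[x - x1](subrKA z); exact: ND.
  have h3 : s <= kp * s by rewrite ler_peMl// ltW.
  by nra.
(* Here t <= 1 because x is farthest from x1 up to the factor q, and t (x - x1) falls only slightly
   short of y - x1 in length. *)
set t := m / (q * n).
have qn0 : 0 < q * n by rewrite mulr_gt0.
have t0 : 0 < t by rewrite divr_gt0.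
have t1 : t <= 1 by rewrite ler_pdivrMr// mul1r.
(* The error between y and the convex combination of x and z. Absorbed into x, it leaves N e <= l t
   to prove, which puts x + e / t into the homothet at x. *)
set e := (1 - t) *: (x1 - z) + ((y - x1) - t *: (x - x1)).
have ye : y = t *: (x + t^-1 *: e) + (1 - t) *: z.
  rewrite scalerDr scalerA divff ?gt_eqF// scale1r /e.
  apply/rowP => i; rewrite !mxE; ring.
rewrite ye; apply: homothet_convex => //; last by rewrite ltW.
apply: homothet_inner => //.
rewrite [x + _]addrC addrK NZ gtr0_norm ?invr_gt0// mulrC ler_pdivrMr//.
(* The first summand of e costs s; in the second, the angle between the directions and the defect 1
   - 1/q cost eps m each. *)
have he : N e <= s + 2 * eps * m.
  apply: (le_trans (ND _ _)); apply: lerD.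
    rewrite NZ ger0_norm ?subr_ge0// NC.
    apply: (@le_trans _ _ (1 * N (z - x1))); last by rewrite mul1r.
    by rewrite ler_wpM2r// ?/N//; lra.
  have -> : N (y - x1 - t *: (x - x1)) =
      `|m *: ((direction x1 y - direction x1 x)
         + (1 - q^-1) *: direction x1 x)|.
    rewrite /N mulmxBl -scalemxAl /direction -/n -/m; congr `| _ |.
    apply/rowP => i; rewrite !mxE /t; field.
    by rewrite !gt_eqF.
  rewrite normrZ gtr0_norm// mulrC ler_pM2r//.
  apply: (le_trans (ler_normD _ _)).
  have q1 : 0 <= 1 - q^-1 <= eps.
    have : q^-1 * q = 1 by rewrite mulVf// gt_eqF.
    have : 0 < q^-1 by rewrite invr_gt0.
    by rewrite /q => h1 h2; apply/andP; split; nra.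
  rewrite normrZ norm_direction// mulr1.
  by case/andP: q1 => q1 q2; rewrite (ger0_norm q1); lra.
apply: (le_trans he).
have tl : m <= 4 * kp * (l * t).
  have -> : m = t * (q * n) by rewrite /t mulfVK// gt_eqF.
  have h1 : q * n <= 2 * n by rewrite ler_wpM2r// ?/q; lra.
  have : t * (q * n) <= t * (2 * n) by rewrite ler_pM2l.
  have : t * n <= t * (2 * kp * l) by rewrite ler_pM2l.
  by lra.
(* Both kp s and 2 m kp eps are at most m / 8, and m / 4 <= kp l t. *)
have h4 : kp * (s + 2 * eps * m) <= kp * (l * t).
  have -> : kp * (s + 2 * eps * m) = kp * s + 2 * m * (kp * eps) by ring.
  by rewrite kpe; lra.
by move: h4; rewrite ler_pM2l// mulrC.
Qed.

Definition N_bounded (A : set V) := exists B, forall y, A y -> N y <= B.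

(** Centers are sorted by the grid cell of their direction from x1. In each cell the almost farthest
    center covers the others by [cone_cover], as k >= 16 kp makes directions of one cell close
    enough. *)
Lemma far_cover (x1 : V) (s : R) (A : set V) : 0 < s -> N_bounded A ->
  exists ys : seq V, (size ys <= K)%N /\
    forall y z, A y -> 8 * kp * s <= N (y - x1) -> Y y z -> N (z - x1) <= s ->
      exists2 x, x \in ys & Y x y.
Proof.
move=> s0 [B hB].
set F := [set y | [/\ A y, 8 * kp * s <= N (y - x1) &
  exists2 z, Y y z & N (z - x1) <= s]].
have [t|ys [h1 h2 h3]] := @class_cover _
    (fun y => grid_class k (direction x1 y)) F.
  move=> [y0 Fy0 ct0]; set eps := (16 * kp)^-1.
  have eps0 : 0 < eps by rewrite invr_gt0 mulr_gt0.
  have pos y : F y -> 0 < N (y - x1).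
    by move=> [_ h _]; apply: lt_le_trans h; rewrite !mulr_gt0.
  have [||||x [Fx cx] hx] := @near_argmax R V
     [set y | F y /\ grid_class k (direction x1 y) = t]
     (fun y => N (y - x1)) (1 + eps).
  - by rewrite ltrDl.
  - by exists y0.
  - by move=> y [/pos].
  - exists (B + N (- x1)) => y [[Ay _ _] _].
    by apply: (le_trans (ND _ _)); rewrite lerD2r; exact: hB.
  exists x => // y Fy cy; have [_ hx2 [z Yz hz]] := Fx.
  have [_ hy2 _] := Fy.
  apply: (@cone_cover x1 x y z s eps) => //; first exact: hx.
  have := @grid_class_close R d k (direction x1 y) (direction x1 x).
  rewrite !norm_direction ?pos// cx cy => /(_ (lexx _) (lexx _) erefl) h.
  rewrite /eps -[leRHS]mul1r ler_pdivlMr ?mulr_gt0// mulrC.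
  apply: le_trans h; rewrite ler_wpM2r//; apply: le_trans k_large.
  by rewrite ler_pM2l// expr2 ler_peMl// ltW.
exists ys; split => // y z Ay hy Yz hz; apply: h3.
by split => //; exists z.
Qed.

(** Two centers in one cell of the rescaled grid are at distance at most 8 kp^2 lam x1 / k <= lam x1
    / 2, which is at most lam y for all y in A. So any member of a cell represents it. *)
Lemma near_cover (x1 : V) (A : set V) :
  (forall y, A y -> lam x1 <= 2 * lam y) ->
  exists ys : seq V, (size ys <= K)%N /\
    forall y, A y -> N (y - x1) <= 8 * kp * (kp * lam x1) ->
      exists2 x, x \in ys & Y x y.
Proof.
move=> hA; have l0 := lam_gt0 x1.
set r := 8 * kp * (kp * lam x1).
have r0 : 0 < r by rewrite !mulr_gt0.
set F := [set y | A y /\ N (y - x1) <= r].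
pose cl y := grid_class k (r^-1 *: ((y - x1) *m L)).
have sc y : F y -> `|r^-1 *: ((y - x1) *m L)| <= 1.
  move=> [_ h]; rewrite normrZ gtr0_norm ?invr_gt0// mulrC.
  by rewrite ler_pdivrMr// mul1r.
have [t|ys [h1 h2 h3]] := @class_cover _ cl F.
  move=> [x Fx cx]; exists x => // y Fy cy.
  apply: homothet_inner => //.
  have := @grid_class_close R d k _ _ (sc y Fy) (sc x Fx).
  rewrite -/(cl y) -/(cl x) cx cy => /(_ erefl).
  rewrite -scalerBr -mulmxBl normrZ gtr0_norm ?invr_gt0//.
  rewrite opprB addrA subrK -/(N _) => h.
  have h' : k%:R * N (y - x) <= r.
    by move: h; rewrite mulrCA mulrC ler_pdivrMr// mul1r.
  have hx := hA x Fx.1.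
  have : k%:R * N (y - x) <= k%:R * lam x.
    apply: (le_trans h'); apply: (@le_trans _ _ (16 * kp ^+ 2 * lam x)).
      rewrite /r; have : 0 < kp ^+ 2 by rewrite exprn_gt0.
      rewrite expr2; nra.
    by rewrite ler_pM2r.
  by rewrite ler_pM2l.
by exists ys; split => // y Ay hy; apply: h3.
Qed.

Definition disjoint_homothets (xs : seq V) :=
  forall x y, x \in xs -> y \in xs -> x <> y -> Y x `&` Y y = set0.

Let YC x : Y x x.
Proof. by apply: homothet_inner => //; rewrite subrr /N mul0mx normr0 ltW. Qed.

(** Among the centers whose homothets meet the chosen one, the far and the near ones need at most K
    homothets each, which gives 2K per choice. The recursion stops after n choices, whether or not A
    is exhausted. *)
Lemma greedy_selection n (A : set V) : N_bounded A ->
  (exists2 e, 0 < e & forall y, A y -> e <= lam y) ->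
  exists xs : seq V, [/\ uniq xs, (forall x, x \in xs -> A x),
    disjoint_homothets xs &
    size xs = n \/ exists2 ys : seq V, (size ys <= K.*2 * size xs)%N &
      forall y, A y -> exists2 x, x \in ys & Y x y].
Proof.
elim: n A => [|n IH] A Ab [e e0 hA]; first by exists [::]; split => //; left.
have [->|/set0P A0] := eqVneq A set0.
  exists [::]; split => //.
  by right; exists [::].
(* Applied to 1 / lam, which is bounded by 1 / e: the chosen homothet is at most twice as large as
   any other with center in A. *)
have [|||x1 Ax1 hx1] := @near_argmax R V A (fun y => (lam y)^-1) 2 _ A0.
- by rewrite ltr1n.
- by move=> x _; rewrite invr_gt0.
- by exists e^-1 => y Ay; rewrite lef_pV2 ?posrE//; exact: hA.
have {}hx1 y : A y -> lam x1 <= 2 * lam y.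
  move=> /hx1; rewrite -[_^-1]mul1r ler_pdivrMr// mulrAC.
  by rewrite ler_pdivlMr// mul1r.
pose A' := [set y | A y /\ Y y `&` Y x1 = set0].
have [||xs [xs_uniq xsA xs_disj hxs]] := IH A'.
- by case: Ab => B hB; exists B => y [/hB].
- by exists e => // y [/hA].
exists (x1 :: xs); split => /=.
- rewrite xs_uniq andbT; apply/negP => /xsA [_].
  by rewrite setIid => h; have := YC x1; rewrite h.
- by move=> x; rewrite inE => /orP[/eqP->//|/xsA[]].
- move=> x y; rewrite !inE => /orP[/eqP->|hx] /orP[/eqP->|hy] // ne.
  + by rewrite setIC; exact: (xsA _ hy).2.
  + exact: (xsA _ hx).2.
  + exact: xs_disj.
case: hxs => [->|[ys sys hys]]; [by left|right].
(* All points of the homothet at x1 are within kp lam x1 of x1. With this s the far and the near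
   range together contain all centers. *)
have s0 : 0 < kp * lam x1 by rewrite mulr_gt0.
have [fs [sfs hfs]] := @far_cover x1 _ A s0 Ab.
have [ns [sns hns]] := @near_cover x1 A hx1.
exists (fs ++ ns ++ ys).
  by rewrite !size_cat mulnS addnA leq_add// -addnn leq_add.
move=> y Ay.
have [disj|] := pselect (Y y `&` Y x1 = set0).
  have [x xys Yx] := hys y (conj Ay disj).
  by exists x => //; rewrite !mem_cat xys !orbT.
move=> /eqP /set0P [z [Yyz Yxz]].
have hz : N (z - x1) <= kp * lam x1 by exact: homothet_outer.
have [far|/ltW near] := leP (8 * kp * (kp * lam x1)) (N (y - x1)).
  have [x xf Yx] := hfs y z Ay far Yyz hz.
  by exists x => //; rewrite !mem_cat xf.
have [x xn Yx] := hns y Ay near.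
by exists x => //; rewrite !mem_cat xn !orbT.
Qed.

End Selection.

(** * Monotonicity, subadditivity and continuity of Borel measures *)

Section BorelMeasures.
Variables (R : realType) (d : nat).
Notation V := 'rV[R]_d.
Notation VB := (g_sigma_algebraType (@open V)).

(* Truncation at 0 makes mu nonnegative also outside the Borel sets. *)
Definition borel_trunc (mu : set V -> \bar R) (h : is_borel_measure mu) :
  set VB -> \bar R := fun A => maxe 0%E (mu A).

Section Trunc.
Variables (mu : set V -> \bar R) (h : is_borel_measure mu).

Lemma borel_truncE (A : set V) : borel_set A -> borel_trunc h A = mu A.
Proof.
have [_ pos _ _] := h => bA; rewrite /borel_trunc.
by apply/max_idPr; exact: pos.
Qed.

Let trunc0 : borel_trunc h set0 = 0%E.
Proof. by have [m0 _ _ _] := h; rewrite /borel_trunc m0 maxxx. Qed.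

Let trunc_ge0 A : (0 <= borel_trunc h A)%E.
Proof. by rewrite le_max lexx. Qed.

Let trunc_sigma : semi_sigma_additive (borel_trunc h).
Proof.
move=> F mF tF mU; rewrite borel_truncE//.
rewrite (_ : (fun n => _) = (fun n => \sum_(k < n) mu (F k)))%E.
  by have [_ _ sa _] := h; exact: sa.
apply/funext => n; rewrite big_mkord; apply: eq_bigr => i _.
by rewrite borel_truncE//; exact: mF.
Qed.

HB.instance Definition _ :=
  isMeasure.Build _ VB R (borel_trunc h) trunc0 trunc_ge0 trunc_sigma.

Definition trunc_measure : {measure set VB -> \bar R} := borel_trunc h.

End Trunc.

Variables (mu : set V -> \bar R) (hmu : is_borel_measure mu).

Let nu := trunc_measure hmu.

Let nuE A : borel_set A -> nu A = mu A. Proof. exact: borel_truncE. Qed.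

Lemma borel_open (A : set V) : open A -> borel_set A.
Proof. exact: sub_sigma_algebra. Qed.

Lemma borelC (A : set V) : borel_set A -> borel_set (~` A).
Proof. exact: (@measurableC _ VB). Qed.

Lemma borel_closed (A : set V) : closed A -> borel_set A.
Proof.
move=> cA; rewrite -[A]setCK; apply: borelC; apply: borel_open.
exact: closed_openC.
Qed.

Lemma borel_compact (A : set V) : compact A -> borel_set A.
Proof.
by move=> cA; apply: borel_closed; apply: compact_closed => //; exact: norm_hausdorff.
Qed.

Lemma borelU (A B : set V) : borel_set A -> borel_set B -> borel_set (A `|` B).
Proof. exact: (@measurableU _ VB). Qed.

Lemma borelD (A B : set V) : borel_set A -> borel_set B -> borel_set (A `\` B).
Proof. exact: (@measurableD _ VB). Qed.

Lemma borel_bigcup (F : nat -> set V) :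
  (forall n, borel_set (F n)) -> borel_set (\bigcup_n F n).
Proof. by move=> h; apply: (@bigcupT_measurable _ VB). Qed.

Lemma borel_bigcap (F : nat -> set V) :
  (forall n, borel_set (F n)) -> borel_set (\bigcap_n F n).
Proof. by move=> h; apply: (@bigcapT_measurable _ VB). Qed.

Lemma mu_ge0 A : borel_set A -> (0 <= mu A)%E.
Proof. by case: hmu => _ p _ _; exact: p. Qed.

Lemma mu_le A B : borel_set A -> borel_set B -> A `<=` B -> (mu A <= mu B)%E.
Proof.
move=> bA bB AB; rewrite -!nuE//.
by apply: le_measure => //; rewrite inE.
Qed.

Lemma muU A B : borel_set A -> borel_set B -> (mu (A `|` B) <= mu A + mu B)%E.
Proof.
move=> bA bB; rewrite -!nuE//; last exact: borelU.
exact: measureU2.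
Qed.

Lemma mu_bigcup_le (F : nat -> set V) a : (forall n, borel_set (F n)) ->
  (forall m n, (m <= n)%N -> F m `<=` F n) ->
  (forall n, (mu (F n) <= a)%E) -> (mu (\bigcup_n F n) <= a)%E.
Proof.
move=> bF mF h; have bU := borel_bigcup bF; rewrite -nuE//.
have c : (nu \o F) x @[x --> \oo] --> nu (\bigcup_n F n).
  apply: nondecreasing_cvg_mu => //.
  by move=> m n mn; apply/subsetPset; exact: mF.
apply: (cvge_to_le c); apply: nearW => n /=.
by rewrite nuE.
Qed.

Lemma mu_bigcap_ge (F : nat -> set V) a : (forall n, borel_set (F n)) ->
  (mu (F 0%N) < +oo)%E -> (forall m n, (m <= n)%N -> F n `<=` F m) ->
  (forall n, (a <= mu (F n))%E) -> (a <= mu (\bigcap_n F n))%E.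
Proof.
move=> bF f0 mF h; have bU := borel_bigcap bF; rewrite -nuE//.
have c : (nu \o F) x @[x --> \oo] --> nu (\bigcap_n F n).
  apply: nonincreasing_cvg_mu => //; first by rewrite nuE.
  by move=> m n mn; apply/subsetPset; exact: mF.
apply: (cvge_to_ge c); apply: nearW => n /=.
by rewrite nuE.
Qed.

Lemma compact_mu_fin K : compact K -> mu K \is a fin_num.
Proof.
move=> cK; case: hmu => _ _ _ hf; rewrite ge0_fin_numE; first exact: hf.
by apply: mu_ge0; exact: borel_compact.
Qed.

End BorelMeasures.

(** * Euclidean balls and their comparison with the max norm *)

Section EuclideanBall.
Variables (R : realType) (d : nat).
Notation V := 'rV[R]_d.

Lemma enorm_continuous : continuous (@enorm R d).
Proof.
have sc (s : seq 'I_d) : continuous (fun x : V => \sum_(i <- s) x ord0 i ^+ 2).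
  elim: s => [|i s IH].
    rewrite (_ : (fun _ => _) = cst 0); first exact: cst_continuous.
    by apply/funext => x; rewrite big_nil.
  rewrite (_ : (fun _ => _) = (fun x : V => x ord0 i * x ord0 i)
      + (fun x => \sum_(j <- s) x ord0 j ^+ 2)).
    move=> x; apply: continuousD; last exact: IH.
    by apply: continuousM; exact: coord_continuous.
  by apply/funext => x; rewrite big_cons expr2.
move=> x; apply: (@continuous_comp _ _ _ (fun x : V => \sum_i x ord0 i ^+ 2)).
  exact: sc.
exact: sqrt_continuous.
Qed.

Lemma eball_open r : open (@eball R d r).
Proof.
rewrite (_ : eball r = (@enorm R d) @^-1` [set y | y < r])//.
apply: open_comp; last exact: open_lt.
by move=> x _; exact: enorm_continuous.
Qed.

Lemma norm_le_enorm (x : V) : `|x| <= enorm x.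
Proof.
apply/normmx_leP; first exact: sqrtr_ge0.
move=> j i; rewrite ord1 -sqrtr_sqr ler_wsqrtr// (bigD1 i)//= lerDl.
by apply: sumr_ge0 => k _; exact: sqr_ge0.
Qed.

Lemma eball_subset r s : r <= s -> @eball R d r `<=` eball s.
Proof. by move=> rs x /= h; exact: lt_le_trans rs. Qed.

Lemma bigcup_eball : \bigcup_n @eball R d n%:R = setT.
Proof.
rewrite -subTset => x _; exists (Num.bound (enorm x)) => //=.
have := archi_boundP (sqrtr_ge0 _ : 0 <= enorm x); exact.
Qed.

Lemma closed_ball_compact (r : R) : compact [set x : V | `|x| <= r].
Proof.
apply: bounded_closed_compact.
  exists r; split; first exact: num_real.
  by move=> e re x /= xr; apply: le_trans (ltW re).
rewrite (_ : [set x : V | _] = (fun x : V => `|x|) @^-1` [set y | y <= r])//.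
apply: preimage_closed; last exact: closed_le.
by move=> x _; exact: norm_continuous.
Qed.

End EuclideanBall.

(** * Homothets of prescribed measure around every point *)

Section Radius.
Variables (R : realType) (d : nat).
Notation V := 'rV[R]_d.
Variables (C : set V) (L : 'M[R]_d) (kp : R).
Hypothesis C_convex : Defs.convex_set C.
Hypothesis C_inner : forall x, `|x *m L| <= 1 -> C x.
Hypothesis C_outer : forall x, C x -> `|x *m L| <= kp.
Hypothesis kp_ge1 : 1 <= kp.
Hypothesis L_unit : L \in unitmx.
Hypothesis C_compact : compact C.
Hypothesis d_gt0 : (0 < d)%N.

Let kp0 : 0 < kp. Proof. by rewrite (lt_le_trans ltr01). Qed.

Let C0 : C 0. Proof. by apply: C_inner; rewrite mul0mx normr0. Qed.

Let C_closed : closed C.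
Proof. by apply: compact_closed => //; exact: norm_hausdorff. Qed.

Lemma star_scale t x : 0 <= t <= 1 -> C x -> C (t *: x).
Proof. by move=> t01 Cx; have := C_convex Cx C0 t01; rewrite scaler0 addr0. Qed.

Lemma homothet_compact l x : compact (homothet C l x).
Proof.
apply: continuous_compact C_compact; apply: continuous_subspaceT => y.
by apply: continuousD; [exact: scaler_continuous|exact: cst_continuous].
Qed.

Lemma homothet_le l l' x : 0 < l -> l <= l' -> homothet C l x `<=` homothet C l' x.
Proof.
move=> l0 ll' y /homothetP hy; apply/homothetP; first exact: lt_le_trans ll'.
have l'0 : 0 < l' by exact: lt_le_trans ll'.
have := @star_scale (l / l') _ _ (hy l0).
rewrite scalerA mulrAC divff ?gt_eqF// mul1r; apply.
by rewrite divr_ge0 ?(ltW l0) ?(ltW l'0)//= ler_pdivrMr// mul1r.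
Qed.

Lemma star_closure w : (forall t, 0 < t < 1 -> C (t *: w)) -> C w.
Proof.
move=> h; apply: C_closed => B /nbhs_ballP [e /= e0 eB].
have w0 : 0 < e + `|w| by rewrite ltr_pwDl.
(* The point (1 - u) w is at distance u |w| < e from w. *)
pose u := e / (2 * (e + `|w|)).
have u0 : 0 < u by rewrite divr_gt0// mulr_gt0.
have uw : u * (2 * (e + `|w|)) = e by rewrite mulfVK// gt_eqF// mulr_gt0.
have w1 := normr_ge0 w.
have u1 : u < 1.
  by rewrite ltr_pdivrMr ?mulr_gt0// mul1r; lra.
exists ((1 - u) *: w); split; first by apply: h; apply/andP; split; lra.
apply: eB; rewrite -ball_normE /ball_/= scalerBl scale1r opprB addrC subrK.
by rewrite normrZ gtr0_norm//; nra.
Qed.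

(** Serves continuity in l from above: as C is closed, the larger homothets around x intersect in
    the homothet itself. *)
Lemma homothet_right_closed l x y : 0 < l ->
  (forall l', l < l' -> homothet C l' x y) -> homothet C l x y.
Proof.
move=> l0 h; apply/homothetP => //; apply: star_closure => t /andP[t0 t1].
have hl : l < l / t by rewrite ltr_pdivlMr// gtr_pMr.
have /homothetP := h _ hl; rewrite divr_gt0// => /(_ isT).
by rewrite scalerA invf_div.
Qed.

(** An interior point can be pushed slightly away from x, so it already lies in the homothet of
    ratio l / t. This serves continuity in l from below, and keeps the extremal point of C out of
    the interior. *)
Lemma interior_homothet l x y : 0 < l -> interior (homothet C l x) y ->
  exists2 t, 1 < t & C ((t / l) *: (y - x)).
Proof.
move=> l0 /nbhs_ballP [e /= e0 eH].
set w := y - x; have w1 := normr_ge0 w.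
have w0 : 0 < e + `|w| by rewrite ltr_pwDl.
pose u := e / (2 * (e + `|w|)).
have u0 : 0 < u by rewrite divr_gt0// mulr_gt0.
have uw : u * (2 * (e + `|w|)) = e by rewrite mulfVK// gt_eqF// mulr_gt0.
exists (1 + u); first by lra.
have /homothetP : homothet C l x (y + u *: w).
  apply: eH; rewrite -ball_normE /ball_/= opprD addNKr normrN.
  by rewrite normrZ gtr0_norm//; nra.
move=> /(_ l0); rewrite addrAC -/w -{1}[w]scale1r -scalerDl scalerA.
by rewrite [_^-1 * _]mulrC.
Qed.

(* The point furthest out along a ray from the origin. *)
Lemma extremal_point : exists w : V, C w /\ forall t, 1 < t -> ~ C (t *: w).
Proof.
pose v : V := const_mx 1.
have v0 : v != 0.
  apply/eqP => /matrixP /(_ ord0 (Ordinal d_gt0)); rewrite !mxE.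
  by move=> /eqP; rewrite oner_eq0.
have N0 : 0 < `|v *m L|.
  rewrite normr_gt0; apply: contra v0 => /eqP e.
  by rewrite -[v](mulmxK L_unit) e mul0mx.
pose T := [set t : R | 0 <= t /\ C (t *: v)].
have hT : has_sup T.
  split; first by exists 0; split => //; rewrite scale0r.
  exists (kp / `|v *m L|) => t [t0 /C_outer].
  by rewrite -scalemxAl normrZ ger0_norm// ler_pdivlMr.
have ub t : T t -> t <= sup T by move=> h; exact: (ub_le_sup hT.2).
set s := sup T in ub *.
have s0 : 0 < s.
  apply: (@lt_le_trans _ _ (`|v *m L|^-1)); first by rewrite invr_gt0.
  apply: ub; split; first by rewrite invr_ge0.
  apply: C_inner; rewrite -scalemxAl normrZ gtr0_norm ?invr_gt0//.
  by rewrite mulVf// gt_eqF.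
exists (s *: v); split.
  apply: star_closure => t /andP[t0 t1].
  have e0 : 0 < s - t * s by rewrite subr_gt0 gtr_pMl.
  have [r [r0 Cr] hr] := sup_adherent e0 hT.
  rewrite -/s opprB addrC subrK in hr.
  have rp : 0 < r by apply: lt_trans hr; rewrite mulr_gt0.
  have -> : t *: (s *: v) = (t * s / r) *: (r *: v).
    by rewrite !scalerA mulfVK// gt_eqF.
  apply: star_scale => //; apply/andP; split.
    by rewrite divr_ge0 ?mulr_ge0// ltW.
  by rewrite ler_pdivrMr// mul1r ltW.
move=> t t1; rewrite scalerA => h.
have := ub (t * s); rewrite leNgt ltr_pMl// t1 => H.
suff : false by [].
by apply: H; split => //; rewrite mulr_ge0// ltW// (lt_trans ltr01).
Qed.

Variable mu : set V -> \bar R.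
Hypothesis hmu : is_borel_measure mu.
Hypothesis mu_boundary : forall l x, 0 < l -> mu (boundary (homothet C l x)) = 0%E.
Variable m : \bar R.
Hypothesis m_gt0 : (0 < m)%E.
Hypothesis m_lt : (m < mu setT)%E.

Let bH l x : borel_set (homothet C l x).
Proof. by apply: borel_compact; exact: homothet_compact. Qed.

Let H_closed l x : closed (homothet C l x).
Proof.
by apply: compact_closed; [exact: norm_hausdorff|exact: homothet_compact].
Qed.

Let b_boundary l x : borel_set (boundary (homothet C l x)).
Proof.
apply: borelD; first by apply: borel_closed; exact: closed_closure.
by apply: borel_open; exact: open_interior.
Qed.

(** The translate of C that moves its extremal point w to x has x on its boundary. *)
Lemma mu_point x : mu [set x] = 0%E.
Proof.
have [w [Cw hw]] := extremal_point.
have b1 : borel_set [set x] by apply: borel_compact; exact: compact_set1.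
apply/le_anti; rewrite mu_ge0// andbT -(mu_boundary (x - w) ltr01).
apply: mu_le => // _ ->; split.
  apply: subset_closure; apply/homothetP => //.
  by rewrite invr1 scale1r opprB addrC subrK.
move=> /(interior_homothet ltr01) [t t1].
by rewrite divr1 opprB [x + _]addrC subrK; exact: hw.
Qed.

(** Otherwise, by continuity from above, the null set {x} to which the homothets shrink would have
    measure at least m. *)
Lemma small_homothet x : exists2 l, 0 < l & (mu (homothet C l x) < m)%E.
Proof.
apply: contrapT => hno.
have ge l : 0 < l -> (m <= mu (homothet C l x))%E.
  by move=> l0; rewrite leNgt; apply/negP => h; apply: hno; exists l.
pose F n := homothet C (n.+1%:R^-1) x.
have p n : 0 < n.+1%:R^-1 :> R by rewrite invr_gt0.
have : (m <= mu (\bigcap_n F n))%E.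
  apply: mu_bigcap_ge => //.
  - by move=> n; exact: bH.
  - by case: hmu => _ _ _; apply; exact: homothet_compact.
  - by move=> i j ij; apply: homothet_le => //; rewrite lef_pV2 ?posrE// ler_nat.
  - by move=> n; exact: ge.
rewrite leNgt => /negP; apply; apply: le_lt_trans m_gt0.
rewrite -(mu_point x); apply: mu_le => //.
- by apply: borel_bigcap => n; exact: bH.
- by apply: borel_compact; exact: compact_set1.
move=> y Fy /=; suff e : `|(y - x) *m L| = 0.
  apply/eqP; rewrite -subr_eq0 -[y - x](mulmxK L_unit).
  by move/eqP: e; rewrite normr_eq0 => /eqP ->; rewrite mul0mx.
apply/eqP; rewrite eq_le normr_ge0 andbT leNgt; apply/negP => n0.
have [n] := ltr_add_invr (divr_gt0 n0 kp0).
rewrite add0r ltr_pdivlMr// mulrC ltNge => /negP; apply.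
exact: (homothet_outer C_outer (p n) (Fy n I)).
Qed.

(** The homothets around x exhaust the space because C contains a neighborhood of 0. *)
Lemma large_homothet x : exists2 l, 0 < l & (m < mu (homothet C l x))%E.
Proof.
apply: contrapT => hno.
have le l : 0 < l -> (mu (homothet C l x) <= m)%E.
  by move=> l0; rewrite leNgt; apply/negP => h; apply: hno; exists l.
pose F n := homothet C n.+1%:R x.
have : (mu (\bigcup_n F n) <= m)%E.
  apply: mu_bigcup_le => //.
  - by move=> n; exact: bH.
  - by move=> i j ij; apply: homothet_le => //; rewrite ler_nat.
  - by move=> n; exact: le.
rewrite (_ : \bigcup_n _ = setT) ?leNgt ?m_lt// -subTset => y _.
exists (Num.bound `|(y - x) *m L|) => //=.
apply: (homothet_inner C_inner) => //.
by apply: ltW; apply: lt_trans (archi_boundP _) _; rewrite ?ltr_nat.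
Qed.

(* The measure of x + l C depends monotonically on l, and it is continuous since
   the boundary of a homothet is null. *)
Lemma exists_radius x : exists2 l, 0 < l & mu (homothet C l x) = m.
Proof.
have [l1 l10 hl1] := small_homothet x.
have [l2 l20 hl2] := large_homothet x.
pose S := [set l | 0 < l /\ (mu (homothet C l x) <= m)%E].
have S1 : S l1 by split => //; exact: ltW.
have hS : has_sup S.
  split; first by exists l1.
  exists l2 => l [l0 hl]; rewrite leNgt; apply/negP => ll.
  have := le_lt_trans hl hl2; rewrite ltNge => /negP; apply.
  by apply: mu_le => //; apply: homothet_le => //; exact: ltW.
have ub t : S t -> t <= sup S by move=> h; exact: (ub_le_sup hS.2).
set s := sup S in ub *.
have s0 : 0 < s by apply: lt_le_trans (ub _ S1).
have above l : s < l -> (m <= mu (homothet C l x))%E.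
  move=> sl; rewrite leNgt; apply/negP => /ltW h.
  have /ub : S l by split => //; exact: lt_trans sl.
  by rewrite leNgt sl.
have below l : 0 < l -> l < s -> (mu (homothet C l x) <= m)%E.
  move=> l0 ls; have e0 : 0 < s - l by rewrite subr_gt0.
  have [r [r0 Sr] hr] := sup_adherent e0 hS.
  rewrite -/s opprB addrC subrK in hr.
  by apply: le_trans Sr; apply: mu_le => //; apply: homothet_le => //; exact: ltW.
exists s => //; apply/le_anti/andP; split; last first.
  (* From above: the homothet is the intersection of slightly larger ones, all of measure at least
     m. *)
  pose F n := homothet C (s + n.+1%:R^-1) x.
  have p n : s < s + n.+1%:R^-1 by rewrite ltrDl invr_gt0.
  have : (m <= mu (\bigcap_n F n))%E.
    apply: mu_bigcap_ge => //.
    - by move=> n; exact: bH.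
    - by case: hmu => _ _ _; apply; exact: homothet_compact.
    - move=> i j ij; apply: homothet_le; first exact: lt_trans (p _).
      by rewrite lerD2l lef_pV2 ?posrE// ler_nat.
    - by move=> n; exact: above.
  move=> h; apply: (le_trans h); apply: mu_le => //.
    by apply: borel_bigcap => n; exact: bH.
  move=> y Fy; apply: homothet_right_closed => // l sl.
  have [n hn] := ltr_add_invr sl.
  apply: (homothet_le _ (ltW hn) (Fy n I)); exact: lt_trans (p _).
(* From below: slightly smaller homothets exhaust the interior, and the boundary adds no measure.
   The index n.+2 keeps the factor positive at n = 0. *)
pose F n := homothet C (s * (1 - n.+2%:R^-1)) x.
have p n : 0 < 1 - n.+2%:R^-1 :> R.
  by rewrite subr_gt0 invf_lt1// ltr1n.
have : (mu (\bigcup_n F n) <= m)%E.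
  apply: mu_bigcup_le => //.
  - by move=> n; exact: bH.
  - move=> i j ij; apply: homothet_le; first by rewrite mulr_gt0.
    by rewrite ler_pM2l// lerD2l lerN2 lef_pV2 ?posrE// ler_nat.
  - move=> n; apply: below; first by rewrite mulr_gt0.
    by rewrite gtr_pMr// gtrBl invr_gt0.
apply: le_trans.
set H := homothet C s x.
have e : H = boundary H `|` interior H.
  rewrite /boundary -(closure_id H).1; last exact: H_closed.
  by rewrite setUC setDUK//; exact: interior_subset.
have bI : borel_set (interior H) by apply: borel_open; exact: open_interior.
apply: (@le_trans _ _ (mu (interior H))).
  by rewrite {1}e; apply: (le_trans (muU hmu (b_boundary _ _) bI)); rewrite /H mu_boundary// add0e.
apply: mu_le => //; first by apply: borel_bigcup => n; exact: bH.
move=> y /(interior_homothet s0) [t t1 Ct].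
have t0 : 0 < t by exact: lt_trans t1.
have : t^-1 < 1 by rewrite invf_lt1.
move=> /ltr_add_invr [n hn]; exists n => //.
apply: (@homothet_le (s / t)).
- by rewrite divr_gt0.
- rewrite ler_pM2l// lerBrDr; apply: le_trans (ltW hn).
  by rewrite lerD2l lef_pV2 ?posrE// ler_nat.
- by apply/homothetP; rewrite ?divr_gt0// invf_div.
Qed.

(** If y is near x and lam y is small, the homothet at y lies in one at x of measure below m, a
    contradiction. So lam is locally bounded below, and compactness makes the bound uniform. *)
Lemma radius_lower_bound (lam : V -> R) (K : set V) :
  (forall x, 0 < lam x) -> (forall x, mu (homothet C (lam x) x) = m) ->
  compact K -> exists2 e, 0 < e & forall y, K y -> e <= lam y.
Proof.
move=> lam0 hlam /compact_near_coveringP cK.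
have : \forall e \near (0 : R)^'+, K `<=` [set y | e <= lam y].
  apply: (cK R (0^'+) (fun e y => e <= lam y)) => x Kx.
  have [l l0 hl] := small_homothet x.
  pose D := d%:R * `|L| + 1; have D0 : 0 < D by rewrite ltr_wpDl// mulr_ge0.
  (* Half of l pays for the distance from y to x, the other half for the size of the homothet at
     y. *)
  exists ([set y | `|(y - x) *m L| <= l / 2], [set e : R | e < l / (2 * kp)]).
    split => /=.
      apply/nbhs_ballP; exists (l / 2 / D) => /=; first by rewrite !divr_gt0.
      move=> y; rewrite -ball_normE /ball_/= ltr_pdivlMr// => h.
      apply: (le_trans (normmxM _ _)); apply: le_trans (ltW h).
      rewrite mulrCA distrC ler_wpM2l// /D lerDl//.
    by apply: nbhs_right_lt; rewrite divr_gt0// mulr_gt0.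
  move=> [y e] [/= hy he]; rewrite leNgt; apply/negP => le.
  have : (m <= mu (homothet C l x))%E.
    rewrite -(hlam y); apply: mu_le => // z hz.
    apply: (homothet_inner C_inner) => //.
    have h1 := homothet_outer C_outer (lam0 y) hz.
    have -> : (z - x) *m L = (z - y) *m L + (y - x) *m L.
      by rewrite -mulmxDl addrA subrK.
    apply: (le_trans (ler_normD _ _)).
    have h2 : kp * lam y <= l / 2.
      move: he; rewrite ltr_pdivlMr ?mulr_gt0// => he.
      have : kp * lam y <= kp * e by rewrite ler_pM2l// ltW.
      by lra.
    by lra.
  by rewrite leNgt hl.
move=> h; near (0 : R)^'+ => e.
exists e => //.
exact: (near h e).
Unshelve. all: by end_near.
Qed.

End Radius.

(** * Dense packings from selections in balls *)

Section Packing.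
Variables (R : realType) (d : nat).
Notation V := 'rV[R]_d.
Variables (C : set V) (L : 'M[R]_d) (kp : R) (k : nat).
Hypothesis C_convex : Defs.convex_set C.
Hypothesis C_inner : forall x, `|x *m L| <= 1 -> C x.
Hypothesis C_outer : forall x, C x -> `|x *m L| <= kp.
Hypothesis kp_ge1 : 1 <= kp.
Hypothesis k_large : 16 * kp ^+ 2 <= k%:R.
Hypothesis C_compact : compact C.
Variable mu : set V -> \bar R.
Hypothesis hmu : is_borel_measure mu.
Variables (m : R) (lam : V -> R).
Hypothesis m_gt0 : 0 < m.
Hypothesis m_lt : (m%:E < mu setT)%E.
Hypothesis lam_gt0 : forall x, 0 < lam x.
Hypothesis mu_lam : forall x, mu (homothet C (lam x) x) = m%:E.
Hypothesis lam_lower : forall K, compact K ->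
  exists2 e, 0 < e & forall y, K y -> e <= lam y.

Let Y (x : V) : set V := homothet C (lam x) x.
Let K := #|{: {ffun 'I_d -> 'I_(k.*2).+1}}|.

Let kp0 : 0 < kp. Proof. by rewrite (lt_le_trans ltr01). Qed.

Let bY x : borel_set (Y x).
Proof. by apply: borel_compact; exact: homothet_compact. Qed.

Let bball r : borel_set (@eball R d r).
Proof. by apply: borel_open; exact: eball_open. Qed.

Let K_gt0 : (0 < K)%N.
Proof. by rewrite /K card_ffun !card_ord expn_gt0. Qed.

(** Homothets are peeled off one at a time, each at cost m; E takes the part of A that they leave
    uncovered. *)
Lemma cover_measure (A E : set V) (ys : seq V) : borel_set A -> borel_set E ->
  (forall y, A y -> E y \/ exists2 x, x \in ys & Y x y) ->
  (mu A <= mu E + ((size ys)%:R * m)%:E)%E.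
Proof.
elim: ys A => [|x ys IH] A bA bE cov.
  rewrite mul0r adde0; apply: mu_le => // y /cov [//|[x]].
  by rewrite in_nil.
have bD : borel_set (A `\` Y x) by exact: borelD.
apply: (@le_trans _ _ (mu ((A `\` Y x) `|` Y x))).
  apply: mu_le => //; first exact: borelU.
  by move=> y Ay; have [|] := pselect (Y x y); [right|left].
apply: (le_trans (muU hmu bD (bY x))).
rewrite /= -natr1 mulrDl mul1r EFinD addeA mu_lam; apply: leeD => //.
apply: IH => // y [/cov [|[z]]]; first by left.
rewrite inE => /orP[/eqP -> //|zy Yz _]; right; by exists z.
Qed.

Lemma eball_N_bounded r : N_bounded L (@eball R d r).
Proof.
exists (d%:R * (r * `|L|)) => y /ltW yr; apply: (le_trans (normmxM _ _)).
by rewrite ler_wpM2l// ler_wpM2r// (le_trans (norm_le_enorm y)).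
Qed.

Lemma eball_norm r : @eball R d r `<=` [set x | `|x| <= r].
Proof. by move=> x /ltW; apply: le_trans; exact: norm_le_enorm. Qed.

Lemma eball_fin r : mu (@eball R d r) \is a fin_num.
Proof.
have cB := @closed_ball_compact R d r.
rewrite ge0_fin_numE; last exact: mu_ge0.
apply: (@le_lt_trans _ _ (mu [set x | `|x| <= r])).
  apply: mu_le => //; first exact: borel_compact.
  exact: eball_norm.
by case: hmu => _ _ _; apply.
Qed.

Lemma exists_large_ball (a : \bar R) (r0 : R) : (a < mu setT)%E ->
  exists2 r, r0 <= r & (a < mu (@eball R d r))%E.
Proof.
move=> ha; apply: contrapT => hno.
have le n : (mu (@eball R d n%:R) <= a)%E.
  have [r hr hn] : exists2 r : R, r0 <= r & n%:R <= r.
    by exists (Num.max r0 n%:R); rewrite le_max lexx ?orbT.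
  apply: (@le_trans _ _ (mu (@eball R d r))).
    by apply: mu_le => //; exact: eball_subset.
  by rewrite leNgt; apply/negP => h; apply: hno; exists r.
have : (mu (\bigcup_n @eball R d n%:R) <= a)%E.
  apply: mu_bigcup_le => // i j ij; apply: eball_subset.
  by rewrite ler_nat.
by rewrite bigcup_eball leNgt ha.
Qed.

(** A collects the admissible centers; E and zs account for the rest of the ball. Either the
    selected homothets reach the measure of the ball in total, or a cover of A joins E and zs to
    cover the ball. *)
Lemma packing_in_ball (A E : set V) (zs : seq V) r : borel_set E ->
  A `<=` eball r ->
  (forall y, eball r y -> A y \/ E y \/ exists2 x, x \in zs & Y x y) ->
  exists xs : seq V, [/\ uniq xs, (forall x, x \in xs -> A x),
    disjoint_homothets C lam xs &
    (mu (eball r) <= mu E + ((size zs + K.*2 * size xs)%:R * m)%:E)%E].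
Proof.
move=> bE Ar cov.
have Ab : N_bounded L A.
  by have [B hB] := eball_N_bounded r; exists B => y /Ar; exact: hB.
have [e e0 he] := lam_lower (@closed_ball_compact R d r).
have Al : exists2 e, 0 < e & forall y, A y -> e <= lam y.
  by exists e => // y /Ar /eball_norm; exact: he.
set M := fine (mu (eball r)).
have ME : mu (eball r) = M%:E by rewrite fineK//; exact: eball_fin.
have M0 : 0 <= M by rewrite fine_ge0//; exact: mu_ge0.
(* More than M / m homothets of measure m outweigh the ball. *)
have [xs [xs_uniq xsA xs_disj hxs]] :=
  greedy_selection C_convex C_inner C_outer kp_ge1 k_large lam_gt0
    (Num.bound (M / m)) Ab Al.
exists xs; split => //; case: hxs => [sx|[ys sys hys]].
  apply: (@le_trans _ _ (0 + ((size zs + K.*2 * size xs)%:R * m)%:E)%E).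
    rewrite add0e ME lee_fin -ler_pdivrMr// ltW//.
    apply: (lt_le_trans (archi_boundP _)); first by rewrite divr_ge0// ltW.
    rewrite ler_nat sx; apply: leq_trans (leq_addl _ _).
    by rewrite leq_pmull// double_gt0.
  by apply: leeD => //; exact: mu_ge0.
apply: (@le_trans _ _ (mu E + ((size (zs ++ ys))%:R * m)%:E)%E).
  apply: cover_measure => // y /cov [Ay|[Ey|[x xz Yx]]].
  - by right; have [x xy Yx] := hys y Ay; exists x => //; rewrite mem_cat xy orbT.
  - by left.
  - by right; exists x => //; rewrite mem_cat xz.
rewrite leeD2l// lee_fin ler_pM2r// ler_nat size_cat leq_add2l.
exact: sys.
Qed.

(** Each homothet has measure m and meets the ball at its center, so this is density at least 1/(4K)
    at radius r: a factor 2K is due to the selection, and 2 to giving up half of the measure. *)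
Definition dense_in_ball (S : set V) (r : R) := exists xs : seq V,
  [/\ uniq xs, (forall x, x \in xs -> S x /\ eball r x), (0 < mu (eball r))%E &
   (mu (eball r) <= ((4 * K * size xs)%:R * m)%:E)%E].

(* Members of a packing that avoids the ball of radius s only lose a part of the
   ball of radius r whose measure does not depend on r. *)
Lemma extend_packing (ps : seq V) (r0 : R) : mu setT = +oo%E ->
  disjoint_homothets C lam ps ->
  exists2 xs : seq V, disjoint_homothets C lam (ps ++ xs) &
    exists2 r, r0 <= r & dense_in_ball [set` xs] r.
Proof.
move=> minf dps.
(* All homothets chosen so far lie in the region of radius s around 0, measured after applying L. *)
have [s s0 hs] : exists2 s, 0 < s & forall p, p \in ps ->
    forall z, Y p z -> `|z *m L| <= s.
  elim: (ps) => [|p qs [s s0 IH]]; first by exists 1.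
  exists (Num.max s (`|p *m L| + kp * lam p)); first by rewrite lt_max s0.
  move=> q; rewrite inE => /orP[/eqP ->|/IH h] z Yz; rewrite le_max.
    apply/orP; right; have := homothet_outer C_outer (lam_gt0 p) Yz.
    rewrite -(lerD2l `|p *m L|); apply: le_trans.
    by rewrite -{1}[z](subrK p) mulmxDl addrC; exact: ler_normD.
  by rewrite h.
(* E contains all centers that are too close to 0 for [far_cover]. *)
pose E := homothet C (8 * kp * s) 0.
have cE : compact E by exact: homothet_compact.
have bE := borel_compact cE.
set e := fine (mu E).
have eE : mu E = e%:E by rewrite fineK//; exact: compact_mu_fin.
have e0 : 0 <= e by rewrite fine_ge0//; exact: mu_ge0.
(* As mu is infinite, E and K further homothets account for less than half of a large ball. *)
have [r rr0 hr] : exists2 r, r0 <= r &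
    ((2 * (e + K%:R * m))%:E < mu (@eball R d r))%E.
  by apply: exists_large_ball; rewrite minf ltry.
have [zs [szs hzs]] := far_cover C_convex C_inner C_outer kp_ge1 k_large
  lam_gt0 0 s0 (eball_N_bounded r).
pose A := [set y : V | eball r y /\ forall z, Y y z -> s < `|z *m L|].
have [xs [xs_uniq xsA xs_disj hxs]] : exists xs : seq V,
   [/\ uniq xs, (forall x, x \in xs -> A x), disjoint_homothets C lam xs &
    (mu (eball r) <= mu E + ((size zs + K.*2 * size xs)%:R * m)%:E)%E].
  apply: packing_in_ball => //; first by move=> y [].
  move=> y yr.
  have [hA|] := pselect (forall z, Y y z -> s < `|z *m L|); first by left.
  (* The homothet of a rejected center reaches the region of radius s: far centers are covered by
     zs, the others lie in E. *)
  move=> /existsNP [z /not_implyP [Yz /negP]]; rewrite -leNgt => zs_.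
  right; have [far|near] := leP (8 * kp * s) `|y *m L|.
    by right; apply: (hzs y z) => //; rewrite subr0.
  left; apply: (homothet_inner C_inner); first by rewrite !mulr_gt0.
  by rewrite subr0 ltW.
exists xs.
  move=> x y; rewrite !mem_cat => /orP[hx|hx] /orP[hy|hy] ne.
  - exact: dps.
  - apply/seteqP; split => // z [Yxz Yyz].
    have := (xsA _ hy).2 z Yyz; rewrite ltNge => /negP; apply.
    exact: hs Yxz.
  - apply/seteqP; split => // z [Yxz Yyz].
    have := (xsA _ hx).2 z Yxz; rewrite ltNge => /negP; apply.
    exact: hs Yyz.
  - exact: xs_disj.
exists r => //; exists xs; split => //.
- by move=> x hx; split => //; exact: (xsA _ hx).1.
- apply: le_lt_trans hr; rewrite lee_fin mulr_ge0// addr_ge0// mulr_ge0// ltW//.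
move: hr hxs; rewrite eE -(fineK (eball_fin r)) -EFinD !lte_fin !lee_fin.
set M := fine _; rewrite -(ler_nat R) in szs.
rewrite natrD mulrDl -muln2 => h1 h2.
have h3 : (size zs)%:R * m <= K%:R * m by rewrite ler_pM2r.
have -> : (4 * K * size xs)%:R * m = 2 * ((K * 2 * size xs)%:R * m).
  by rewrite !natrM; ring.
by lra.
Qed.

(** If mu is finite, one selection in a ball with more than half of the total measure serves all
    larger radii. If mu is infinite, extensions at radii at least 0, 1, 2, ... are concatenated. *)
Lemma exists_dense_packing : exists S : set V,
  (forall x y, S x -> S y -> x <> y -> Y x `&` Y y = set0) /\
  forall r0, exists2 r, r0 <= r & dense_in_ball S r.
Proof.
have [minf|mfin] := eqVneq (mu setT) +oo%E; last first.
  have bT : borel_set [set: V] by apply: borel_open; exact: openT.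
  have m0 : (0 <= mu setT)%E by exact: mu_ge0.
  set M := fine (mu setT).
  have ME : mu setT = M%:E by rewrite fineK// ge0_fin_numE// ltey.
  have mM : m < M by move: m_lt; rewrite ME lte_fin.
  have M0 : 0 < M by exact: lt_trans mM.
  have [r1 _ hr1] : exists2 r, 0 <= r & ((M / 2)%:E < mu (@eball R d r))%E.
    by apply: exists_large_ball; rewrite ME lte_fin; lra.
  have b0 : borel_set (set0 : set V) by apply: borel_open; exact: open0.
  have [xs [xs_uniq xsA xs_disj hxs]] :=
    @packing_in_ball (eball r1) set0 [::] r1 b0 (fun=> id)
      (fun y h => or_introl h).
  exists [set` xs]; split; first by move=> x y; exact: xs_disj.
  move=> r0; exists (Num.max r0 r1); first by rewrite le_max lexx.
  have sub : @eball R d r1 `<=` eball (Num.max r0 r1).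
    by apply: eball_subset; rewrite le_max lexx orbT.
  have le := mu_le hmu (bball _) (bball _) sub.
  exists xs; split => //.
  - by move=> x hx; split => //; apply: sub; exact: xsA.
  - apply: lt_le_trans le; apply: le_lt_trans hr1.
    by rewrite lee_fin divr_ge0// ltW.
  apply: (@le_trans _ _ M%:E).
    by rewrite -ME; apply: mu_le.
  have [mu0 _ _ _] := hmu.
  have := lt_le_trans hr1 hxs; rewrite mu0 add0e lte_fin lee_fin add0n -muln2.
  by rewrite !natrM; lra.
(* The premise sits under the existential, so that g is a total function that can be iterated. *)
have /choice [g hg] : forall pn : seq V * nat, exists xs : seq V,
    disjoint_homothets C lam pn.1 ->
    disjoint_homothets C lam (pn.1 ++ xs) /\
    exists2 r, pn.2%:R <= r & dense_in_ball [set` xs] r.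
  move=> [ps n] /=.
  have [dp|ndp] := pselect (disjoint_homothets C lam ps); last by exists [::].
  by have [xs h1 h2] := extend_packing n%:R minf dp; exists xs.
pose f := fix f n := if n is n'.+1 then f n' ++ g (f n', n') else [::].
have fdisj n : disjoint_homothets C lam (f n).
  by elim: n => [//|n IH]; exact: (hg (f n, n) IH).1.
have fsub i j : (i <= j)%N -> {subset f i <= f j}.
  move=> /subnK <-; elim: (j - i)%N => [//|n IH] x /IH h.
  by rewrite addSn /= mem_cat h.
exists [set x | exists n, x \in f n]; split.
  move=> x y [i xi] [j yj].
  apply: (fdisj (maxn i j)).
    by apply: fsub xi; exact: leq_maxl.
  by apply: fsub yj; exact: leq_maxr.
move=> r0; set n := Num.bound `|r0|.
have [_ [r nr [xs [h1 h2 h3 h4]]]] := hg (f n, n) (fdisj n).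
exists r.
  apply: le_trans nr; apply: (le_trans (ler_norm _)); apply: ltW.
  exact: archi_boundP.
exists xs; split => // x /h2 [gx rx]; split => //.
by exists n.+1; rewrite /= mem_cat gx orbT.
Qed.

(** Dense radii occur beyond every r0, so each supremum in the limsup is large. *)
Lemma d_upp_ge (S : set V) :
  (forall x y, S x -> S y -> x <> y -> Y x `&` Y y = set0) ->
  (forall r0, exists2 r, r0 <= r & dense_in_ball S r) ->
  (((4 * K)%:R^-1)%:E <= d_upp mu [set Y x | x in S])%E.
Proof.
move=> dS hS; apply/ereal_infP => _ [r0 _ <-].
have [r rr [xs [xs_uniq xsS M0 hM]]] := hS r0.
apply: (@le_trans _ _ (d_out mu [set Y x | x in S] (eball r))); last first.
  by apply: ereal_sup_ubound; exists r.
have YC x : Y x x.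
  by apply: (homothet_inner C_inner) => //; rewrite subrr mul0mx normr0 ltW.
(* Disjoint nonempty homothets are distinct, so the sum over the family of sets counts every center
   of xs. *)
have Yinj : set_inj [set` xs] Y.
  move=> x y; rewrite !inE => hx hy e; apply: contrapT => ne.
  have := dS x y (xsS _ hx).1 (xsS _ hy).1 ne.
  by rewrite -e setIid => h; have := YC x; rewrite h.
rewrite /d_out; set M := fine (mu (eball r)).
have ME : mu (eball r) = M%:E by rewrite fineK//; exact: eball_fin.
move: M0 hM; rewrite ME lte_fin lee_fin => M0 hM.
rewrite lee_pdivlMr//; apply: esum_ge.
exists [set Y x | x in [set` xs]].
  split; first by apply: finite_image; exact: finite_seq.
  move=> _ [x /= hx <-]; split; first by exists x => //; exact: (xsS _ hx).1.
  by exists x; split => //; exact: (xsS _ hx).2.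
rewrite fsbig_image// -fsbig_seq//.
under eq_bigr do rewrite mu_lam.
rewrite sumEFin lee_fin big_const_seq count_predT iter_addr_0 -[leRHS]mulr_natl.
rewrite mulrC ler_pdivrMr ?ltr0n ?muln_gt0//.
by rewrite -mulrA [m * _]mulrC mulrA -natrM [(size xs * _)%N]mulnC.
Qed.

End Packing.

(** * The explicit constant and the conclusion *)

Definition grid_size (R : realType) (d : nat) : nat :=
  Num.bound (16 * kap R d ^+ 2).

Definition density_bound (R : realType) (d : nat) : R :=
  (4 * #|{: {ffun 'I_d -> 'I_((grid_size R d).*2).+1}}|)%:R^-1.

Theorem mainTheorem5 (R : realType) :
  exists G : nat -> R, (forall d, 0 < G d) /\
    forall (d : nat) (C : set 'rV[R]_d) (mu : set 'rV[R]_d -> \bar R),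
      convex_body C -> is_borel_measure mu -> non_degenerate mu C ->
      (0 < mu C)%E -> (mu C < mu setT)%E ->
      ((G d)%:E <= delta_H mu C)%E.
Proof.
exists (density_bound R); split.
  by move=> d; rewrite invr_gt0 ltr0n muln_gt0/= card_ffun !card_ord expn_gt0.
move=> d C mu Cbody hmu nd C_gt0 C_lt.
have [Cc Ck Ci] := Cbody.
(* In dimension 0 the body is the whole space, against mu C < mu setT. *)
have [z|d_gt0] := posnP d.
  have CT : C = setT.
    have [x Cx] := Ci; rewrite -subTset => y _.
    suff -> : y = x by exact: interior_subset.
    by move: x y {Cx}; rewrite z => x y; apply/rowP => -[].
  by move: C_lt; rewrite CT ltxx.
have [c [L [L_unit inner outer]]] := john_position Cbody.
(* The center c is moved to the origin; homothets of C0 are homothets of C with another translation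
   vector. *)
pose C0 : set 'rV[R]_d := [set v | C (c + v)].
have C0E l x : homothet C0 l x = homothet C l (x - l *: c).
  apply/seteqP; split => _ [v Cv <-].
    by exists (c + v) => //; apply/rowP => i; rewrite !mxE; ring.
  exists (v - c); first by rewrite /C0/= addrC subrK.
  by apply/rowP => i; rewrite !mxE; ring.
have C0_convex : Defs.convex_set C0.
  move=> y z t Cy Cz t01; rewrite /C0/=.
  have -> : c + (t *: y + (1 - t) *: z) =
      t *: (c + y) + (1 - t) *: (c + z).
    by rewrite !scalerDr addrACA -scalerDl [t + _]addrC subrK scale1r.
  exact: Cc.
have C0_compact : compact C0.
  have -> : C0 = homothet C 1 (- c).
    apply/seteqP; split => [v Cv|_ [v Cv <-]].
      by exists (c + v) => //; rewrite scale1r addrAC subrr add0r.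
    by rewrite /C0/= scale1r addrC subrK.
  exact: homothet_compact.
have kp1 : 1 <= kap R d.
  have : 1 <= d.+1%:R ^+ 2 :> R by rewrite -natrX ler1n expn_gt0.
  by rewrite /kap; lra.
have k_large : 16 * kap R d ^+ 2 <= (grid_size R d)%:R.
  by apply/ltW/archi_boundP; rewrite mulr_ge0// sqr_ge0.
set m := fine (mu C).
have mE : mu C = m%:E by rewrite fineK//; exact: compact_mu_fin.
have m_gt0 : 0 < m by move: C_gt0; rewrite mE lte_fin.
have bd l x : 0 < l -> mu (boundary (homothet C0 l x)) = 0%E.
  by move=> l0; rewrite C0E; exact: nd.
have /choice [lam hlam] : forall x, exists l,
    0 < l /\ mu (homothet C0 l x) = m%:E.
  move=> x; rewrite -mE.
  have [l l0 hl] := exists_radius C0_convex inner outer kp1 L_unit C0_compact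
    d_gt0 hmu bd C_gt0 C_lt x.
  by exists l.
have lam0 x := (hlam x).1; have lamE x := (hlam x).2.
have lamb K : compact K -> exists2 e, 0 < e & forall y, K y -> e <= lam y.
  apply: (radius_lower_bound C0_convex inner outer kp1 L_unit C0_compact d_gt0
    hmu bd _ lam0 lamE).
  by rewrite lte_fin.
rewrite mE in C_lt.
have [S [dS hS]] := exists_dense_packing C0_convex inner outer kp1 k_large
  C0_compact hmu m_gt0 C_lt lam0 lamE lamb.
apply: le_trans (d_upp_ge inner hmu lam0 lamE dS hS) _.
apply: ereal_sup_ubound; exists [set homothet C0 (lam x) x | x in S] => //.
split.
  move=> _ _ [x Sx <-] [y Sy <-] ne.
  have xy : x <> y by move=> e; apply: ne; rewrite e.
  apply/seteqP; split => // z [/interior_subset hx /interior_subset hy].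
  by rewrite -(dS x y Sx Sy xy).
move=> _ [x Sx <-]; split; last by rewrite mE.
by exists (lam x), (x - lam x *: c); rewrite -C0E.
Qed.
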